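(* Let $S$ be a finite set, $X$ a set, and $\geq$ a relation on $X^S$ satisfying axioms P'1, P2, P3, P4, P5', L, U and RM. Then there exist a preorder $\geq_\pi$ on $S$, a preorder $\geq_P$ on $X$, and a necessity ordering $\geq_N$ over events obtained from $\geq_\pi$ such that for all acts $f,g\in X^S$, $$f\geq g\iff[f\geq_P g]\ \geq_N\ [g\geq_P f],$$ where $[f\geq_P g]=\{s\in S:f(s)\geq_P g(s)\}$.
   Context: Acts are maps $f:S\to X$. For a relation $\geq$ on $X^S$: $f\sim g$ iff $f\geq g$ and $g\geq f$; $f>g$ iff $f\geq g$ and not $g\geq f$. For $A\subseteq S$, $\bar A=S\setminus A$ and $f_{|A}\cup g_{|\bar A}$ is the act equal to $f$ on $A$ and $g$ on $\bar A$. $f\geq_A g$ iff for all acts $h$, $f_{|A}\cup h_{|\bar A}\geq g_{|A}\cup h_{|\bar A}$; $f\sim_A g$ iff $f\geq_A g$ and $g\geq_A f$. $A$ is null iff $f\geq_A g$ for all acts $f,g$. $f_x$ denotes the constant act with value $x\in X$; $x\geq y$ means $f_x\geq f_y$ (and $x>y$, $x\sim y$ accordingly). For $x>y$ and $C\subseteq S$, $\omega(C)^{x,y}$ is the act equal to $x$ on $C$ and $y$ on $\bar C$. For events $A,B\subseteq S$: $A\geq B$ iff $\omega(A)^{x,y}\geq\omega(B)^{x,y}$ for all $x>y$ in $X$; $A>B$ iff $A\geq B$ and not $B\geq A$. $[f\geq g]=\{s\in S: f(s)\geq g(s)\}$. A preorder is a reflexive transitive relation. A necessity ordering $\geq_N$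 on $2^S$ is obtained from a preorder $\geq_\pi$ on $S$ when there is a possibility distribution $\pi:S\to[0,1]$ encoding it, i.e. $s\geq_\pi s'\Leftrightarrow\pi(s)\geq\pi(s')$, such that, with $\Pi(A)=\max_{s\in A}\pi(s)$, $\Pi(\emptyset)=0$, $\Pi(S)>0$ and $N(A)=1-\Pi(\bar A)$, one has $A\geq_N B\Leftrightarrow N(A)\geq N(B)$. (States with $\pi(s)=0$ are allowed.) Axioms: P'1: $\geq$ is complete on $X^S$; $>$ is transitive and irreflexive; $\sim$ is symmetric and reflexive. P2: for all $A\subseteq S$ and acts $f,g,h,h'$: $f_{|A}\cup h_{|\bar A}\geq g_{|A}\cup h_{|\bar A}\Leftrightarrow f_{|A}\cup h'_{|\bar A}\geq g_{|A}\cup h'_{|\bar A}$. P3: for all non-null $A\subseteq S$ and $x,y\in X$: $f_x\geq_A f_y\Leftrightarrow x\geq y$. P4: for all $A,B\subseteq S$ and $x>y$, $x'>y'$ in $X$: $\omega(A)^{x,y}\geq\omega(B)^{x,y}\Leftrightarrow\omega(A)^{x',y'}\geq\omega(B)^{x',y'}$. P5': there are $x,y,z\in X$ with $x>y>z$. L: for all acts $f,g$: $f\geq g\Leftrightarrow[f\geq g]\geq[g\geq f]$ (comparison of events). U: for all acts $f,g$ and $A\subseteq S$: $f\geq_A g$ and $f\sim_{\bar A}g$ imply $f\geq g$. RM: for all $A,B,C\subseteq S$: $A\cap B>A\cap\bar B$ and $A\cap C\geq A\cap\bar C$ imply $A\cap B\cap C>A\cap\bar B\cap C$. *)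

(* Defs.v *)
From Stdlib Require Export RelationClasses.
From mathcomp Require Export all_boot all_order all_algebra.
From mathcomp Require Export boolp reals.

Set Implicit Arguments.
Unset Strict Implicit.
Unset Printing Implicit Defensive.

Import Order.TTheory GRing.Theory Num.Theory.
Local Open Scope ring_scope.

(* Relations are Prop-valued, so no decidability is assumed. *)

Definition strict_part (T : Type) (r : T -> T -> Prop) (a b : T) : Prop :=
  r a b /\ ~ r b a.

Definition indiff_part (T : Type) (r : T -> T -> Prop) (a b : T) : Prop :=
  r a b /\ r b a.

Section Acts.
Variables (S : finType) (X : Type).

Definition cst_act (x : X) : S -> X := fun=> x.

(* f on A, g on the complement of A *)
Definition glue (A : {set S}) (f g : S -> X) : S -> X :=
  fun s => if s \in A then f s else g s.

(* The act omega(A)^{x,y} *)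
Definition binary_act (A : {set S}) (x y : X) : S -> X :=
  glue A (cst_act x) (cst_act y).

(* [f >= g], for a relation r on consequences; `[< P >] is the classical
   boolean truth value of P. *)
Definition weak_set (r : X -> X -> Prop) (f g : S -> X) : {set S} :=
  [set s | `[< r (f s) (g s) >]].

Variable geq : (S -> X) -> (S -> X) -> Prop.

Definition cond_geq (A : {set S}) (f g : S -> X) : Prop :=
  forall h : S -> X, geq (glue A f h) (glue A g h).

Definition null_event (A : {set S}) : Prop :=
  forall f g : S -> X, cond_geq A f g.

Definition csq_geq (x y : X) : Prop := geq (cst_act x) (cst_act y).

Definition event_geq (A B : {set S}) : Prop :=
  forall x y : X, strict_part csq_geq x y ->
    geq (binary_act A x y) (binary_act B x y).

Definition axiom_P'1 : Prop :=
  [/\ forall f g : S -> X, geq f g \/ geq g f,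
      Transitive (strict_part geq) /\ Irreflexive (strict_part geq)
    & Symmetric (indiff_part geq) /\ Reflexive (indiff_part geq)].

Definition axiom_P2 : Prop :=
  forall (A : {set S}) (f g h h' : S -> X),
    geq (glue A f h) (glue A g h) <-> geq (glue A f h') (glue A g h').

Definition axiom_P3 : Prop :=
  forall A : {set S}, ~ null_event A ->
  forall x y : X, cond_geq A (cst_act x) (cst_act y) <-> csq_geq x y.

Definition axiom_P4 : Prop :=
  forall (A B : {set S}) (x y x' y' : X),
    strict_part csq_geq x y -> strict_part csq_geq x' y' ->
    geq (binary_act A x y) (binary_act B x y) <->
    geq (binary_act A x' y') (binary_act B x' y').

Definition axiom_P5' : Prop :=
  exists x y z : X, strict_part csq_geq x y /\ strict_part csq_geq y z.

Definition axiom_L : Prop :=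
  forall f g : S -> X,
    geq f g <-> event_geq (weak_set csq_geq f g) (weak_set csq_geq g f).

Definition axiom_U : Prop :=
  forall (f g : S -> X) (A : {set S}),
    cond_geq A f g -> indiff_part (cond_geq (~: A)) f g -> geq f g.

Definition axiom_RM : Prop :=
  forall A B C : {set S},
    strict_part event_geq (A :&: B) (A :&: ~: B) ->
    event_geq (A :&: C) (A :&: ~: C) ->
    strict_part event_geq (A :&: B :&: C) (A :&: ~: B :&: C).

End Acts.

Section Possibility.
Variables (R : realType) (S : finType).

(* The default value 0 gives Poss pi set0 = 0, and does not affect the maximum
   over a nonempty event since pi is nonnegative. *)
Definition Poss (pi : S -> R) (A : {set S}) : R :=
  \big[Num.max/0]_(s in A) pi s.

Definition Nec (pi : S -> R) (A : {set S}) : R := 1 - Poss pi (~: A).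

Definition necessity_ordering_from (geq_pi : S -> S -> Prop)
    (geq_N : {set S} -> {set S} -> Prop) : Prop :=
  exists pi : S -> R,
    [/\ forall s, 0 <= pi s <= 1,
        forall s s', geq_pi s s' <-> pi s >= pi s',
        0 < Poss pi [set: S]
      & forall A B : {set S}, geq_N A B <-> Nec pi A >= Nec pi B].

End Possibility.

(* Main.v *)
Require Import Defs.

(*
By L and P2, [f >= g] holds iff the event [f > g] is at least as likely as the
disjoint event [g > f]. Transitivity of [>] on acts taking the three values
[x > y > z] makes strict likelihood of disjoint events monotone and closed under
unions on its losing side. By RM, if [b >= a] and [a :|: c > b], then
[c > a :|: b]; removing losing states one at a time, [A > B] forces [{s} > B] for
some [s] in [A]. RM also makes the order of singletons a weak order, so
comparison of disjoint events is comparison of maximal ranks.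
On consequences, [>=] is transitive as soon as two states are non-null; with
only one, indifference may fail to be transitive, and then one represents [>] by
the preorder "equal or strictly better".
*)

Set Implicit Arguments.
Unset Strict Implicit.
Unset Printing Implicit Defensive.

Import Order.TTheory GRing.Theory Num.Theory.
Local Open Scope ring_scope.

Section Representation.
Variables (S : finType) (X : Type) (geq : (S -> X) -> (S -> X) -> Prop).
Hypotheses (hP1 : axiom_P'1 geq) (hP2 : axiom_P2 geq) (hP3 : axiom_P3 geq).
Hypotheses (hP4 : axiom_P4 geq) (hL : axiom_L geq) (hRM : axiom_RM geq).
Variables (x y z : X).
Hypotheses (xy : strict_part (csq_geq geq) x y).
Hypotheses (yz : strict_part (csq_geq geq) y z).

Notation ege := (event_geq geq).
Notation egt := (strict_part (event_geq geq)).
Notation cge := (csq_geq geq).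
Notation cgt := (strict_part (csq_geq geq)).
Notation cst c := (@cst_act S X c).

(** * Reduction of acts to pairs of disjoint events *)

Definition better_set (f g : S -> X) : {set S} := [set s | `[< cgt (f s) (g s) >]].

Lemma geq_total f g : geq f g \/ geq g f.
Proof. by case: hP1. Qed.

Lemma geq_refl f : geq f f.
Proof. by case: (geq_total f f). Qed.

Lemma gt_acts_trans f g h :
  strict_part geq f g -> strict_part geq g h -> strict_part geq f h.
Proof. case: hP1 => _ [tr _] _; exact: (tr f g h). Qed.

Lemma cgt_trans a b c : cgt a b -> cgt b c -> cgt a c.
Proof. exact: gt_acts_trans. Qed.

Lemma cgtN a b : cgt a b <-> ~ cge b a.
Proof. by split=> [[]|nba] //; split=> //; case: (geq_total (cst a) (cst b)). Qed.

(** P4 lets the fixed pair [x > y] stand for all strict pairs. *)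
Lemma event_geqE A B : ege A B <-> geq (binary_act A x y) (binary_act B x y).
Proof.
split=> [|h a b ab]; first exact.
by apply/(hP4 A B xy ab).
Qed.

Lemma event_geq_total A B : ege A B \/ ege B A.
Proof. by rewrite !event_geqE; apply: geq_total. Qed.

Lemma egtN A B : egt A B <-> ~ ege B A.
Proof. by split=> [[]|nBA] //; split=> //; case: (event_geq_total A B). Qed.

Lemma egtNN A B : ~ egt A B <-> ege B A.
Proof. by rewrite egtN; split=> [/contrapT|h]. Qed.

(** On [A :|: B] the acts of [~: B] and [A] agree, as do those of [~: A] and [B]; outside, P2 turns
    the common value [x] into [y]. *)
Lemma event_geq_setC A B : A :&: B = set0 -> ege (~: B) (~: A) <-> ege A B.
Proof.
move=> /setP dAB; rewrite !event_geqE.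
have -> : binary_act (~: B) x y =
    glue (A :|: B) (binary_act A x y) (cst x).
  apply: funext => s; have := dAB s; rewrite /binary_act /glue !inE.
  by case: (s \in A); case: (s \in B).
have -> : binary_act (~: A) x y =
    glue (A :|: B) (binary_act B x y) (cst x).
  apply: funext => s; have := dAB s; rewrite /binary_act /glue !inE.
  by case: (s \in A); case: (s \in B).
apply: (iff_trans (hP2 _ _ _ _ (cst y))).
suff gl (E : {set S}) : E \subset A :|: B ->
    glue (A :|: B) (binary_act E x y) (cst y) = binary_act E x y.
  by rewrite (gl _ (subsetUl A B)) (gl _ (subsetUr A B)).
move=> /subsetP sE; apply: funext => s; rewrite /binary_act /glue.
by have := sE s; case: (s \in E) => [/(_ isT)->|] //; case: ifP.
Qed.

Lemma better_setC f g : ~: better_set f g = weak_set cge g f.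
Proof.
apply/setP=> s; rewrite !inE -asbool_neg.
apply/idP/idP => /asboolP h; apply/asboolP; first by apply: contrapT => /cgtN.
by move/cgtN.
Qed.

Lemma better_setI f g : better_set f g :&: better_set g f = set0.
Proof.
apply/setP=> s; rewrite !inE; apply/negP.
by case/andP=> /asboolP[ab _] /asboolP[].
Qed.

(** L compares the complements of the two strict preference sets; these sets are disjoint, so
    complements can be removed. *)
Lemma geq_better f g : geq f g <-> ege (better_set f g) (better_set g f).
Proof. by rewrite hL -!better_setC event_geq_setC // better_setI. Qed.

Lemma gt_better f g :
  strict_part geq f g <-> egt (better_set f g) (better_set g f).
Proof. by rewrite /strict_part !geq_better. Qed.

(** * Transitivity of strict preference on three-level acts *)

Definition level (n : nat) : X := match n with 0%N => z | 1%N => y | _ => x end.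

Lemma level_gt m n : (m <= 2)%N -> (n <= 2)%N ->
  cgt (level m) (level n) <-> (n < m)%N.
Proof.
have xz := cgt_trans xy yz.
have nn a b : cgt a b -> ~ cgt b a by move=> [? _] [].
have n0 a : ~ cgt a a by case.
by case: m => [|[|[]]] // _; case: n => [|[|[]]] // _; split=> // ?; exfalso;
  first [exact: (n0 x)|exact: (n0 y)|exact: (n0 z)|exact: (nn _ _ xy)
        |exact: (nn _ _ yz)|exact: (nn _ _ xz)].
Qed.

Lemma better_level (p q : S -> nat) :
  (forall s, p s <= 2)%N -> (forall s, q s <= 2)%N ->
  better_set (level \o p) (level \o q) = [set s | q s < p s]%N.
Proof.
move=> p2 q2; apply/setP=> s; rewrite !inE /=.
by apply/asboolP/idP => /level_gt; apply.
Qed.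

(** Each pair of events records where one of the acts [p], [q], [r] lies above or below another, so
    transitivity of [>] on acts becomes a rule on events. *)
Lemma egt_levels (p q r : S -> nat) (P Q U V Y Z : {set S}) :
  (forall s, [/\ p s <= 2, q s <= 2 & r s <= 2]%N) ->
  (forall s, (s \in P) = (q s < p s)%N /\ (s \in Q) = (p s < q s)%N) ->
  (forall s, (s \in U) = (r s < q s)%N /\ (s \in V) = (q s < r s)%N) ->
  (forall s, (s \in Y) = (r s < p s)%N /\ (s \in Z) = (p s < r s)%N) ->
  egt P Q -> egt U V -> egt Y Z.
Proof.
move=> le2 PQ UV YZ.
have [p2 q2 r2] : [/\ forall s, p s <= 2, forall s, q s <= 2 & forall s, r s <= 2]%N.
  by split=> s; case: (le2 s).
have -> : P = [set s | q s < p s]%N by apply/setP=> s; rewrite inE; case: (PQ s).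
have -> : Q = [set s | p s < q s]%N by apply/setP=> s; rewrite inE; case: (PQ s).
have -> : U = [set s | r s < q s]%N by apply/setP=> s; rewrite inE; case: (UV s).
have -> : V = [set s | q s < r s]%N by apply/setP=> s; rewrite inE; case: (UV s).
have -> : Y = [set s | r s < p s]%N by apply/setP=> s; rewrite inE; case: (YZ s).
have -> : Z = [set s | p s < r s]%N by apply/setP=> s; rewrite inE; case: (YZ s).
rewrite -!better_level // -!gt_better; exact: gt_acts_trans.
Qed.

(** * RM for disjoint events, and null events *)

Lemma egt_RM (P Q C : {set S}) : P :&: Q = set0 -> egt P Q ->
  ege ((P :|: Q) :&: C) ((P :|: Q) :\: C) -> egt (P :&: C) (Q :&: C).
Proof.
move=> /setP dPQ PQ CC; have := hRM (A := P :|: Q) (B := P) (C := C).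
have -> : (P :|: Q) :&: P = P.
  by apply/setP=> s; rewrite !inE; case: (s \in P); case: (s \in Q).
have -> : (P :|: Q) :&: ~: P = Q.
  by apply/setP=> s; have := dPQ s; rewrite !inE; case: (s \in P); case: (s \in Q).
by rewrite -setDE; apply.
Qed.

Lemma event_geq0 A : ege A set0.
Proof.
apply/event_geqE; case: (EM (null_event geq A)) => [nA|nA].
  have := nA (cst x) (cst y) (cst y).
  by congr (geq _ _); apply: funext => s; rewrite /binary_act /glue inE; case: ifP.
have /(hP3 nA)/(_ (cst y)) : cge x y by case: xy.
by congr (geq _ _); apply: funext => s; rewrite /binary_act /glue inE; case: ifP.
Qed.

Lemma egt0P A : egt A set0 <-> ~ null_event geq A.
Proof.
rewrite egtN event_geqE; split=> [h nA|nA h].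
  apply: h; have := nA (cst y) (cst x) (cst y).
  by congr (geq _ _); apply: funext => s; rewrite /binary_act /glue inE; case: ifP.
(* P2 extends the one comparison with [y] outside [A] to every act [k], so P3 would yield
   [y >= x]. *)
case: xy => _; apply; apply/(hP3 nA) => k; apply/(hP2 _ _ _ _ (cst y)).
by move: h; congr (geq _ _); apply: funext => s; rewrite /binary_act /glue inE; case: ifP.
Qed.

Lemma null_eventS (A B : {set S}) :
  A \subset B -> null_event geq B -> null_event geq A.
Proof.
move=> /subsetP sAB nB f g h; have := nB (glue A f h) (glue A g h) h.
congr (geq _ _); apply: funext => s; rewrite /glue;
  by have := sAB s; case: (s \in A) => [/(_ isT)->|] //; case: ifP.
Qed.

Lemma egt0S (A B : {set S}) : A \subset B -> egt A set0 -> egt B set0.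
Proof. by move=> sAB; rewrite !egt0P => nA /(null_eventS sAB). Qed.

Lemma egt_gt0 (A B : {set S}) : A :&: B = set0 -> egt A B -> egt A set0.
Proof.
(* With [C := A], the side condition of RM is again [A >= B], and the conclusion leaves [A] against
   the empty set. *)
move=> dAB AB; have := egt_RM (C := A) dAB AB.
have -> : (A :|: B) :&: A = A by rewrite setUK.
have -> : (A :|: B) :\: A = B.
  apply/setP=> s; have /setP/(_ s) := dAB; rewrite !inE.
  by do !case: (_ \in _).
by rewrite setIid setIC dAB; apply; case: AB.
Qed.

(** * Monotonicity and union for strict likelihood of disjoint events *)

Lemma egt_monol (A A' B : {set S}) : A \subset A' -> A' :&: B = set0 ->
  egt A B -> egt A' B.
Proof.
move=> /subsetP sA /setP dA'B AB.
have A0 : egt A set0.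
  apply: egt_gt0 AB; apply/setP=> s; move: (sA s) (dA'B s); rewrite !inE.
  by case: (s \in A) => // /(_ isT)->.
(* On [A], [A' :\: A], [B] the levels are 2,2,1, then 1,2,2, then 0,1,2. The second act never falls
   below the third, whence the comparison with [set0]. *)
apply: (@egt_levels
  (fun s => if s \in A' then 2 else if s \in B then 1 else 0)%N
  (fun s => if s \in A then 1 else if (s \in A') || (s \in B) then 2 else 0)%N
  (fun s => if s \in A then 0 else if s \in A' then 1 else
            if s \in B then 2 else 0)%N A B A' set0 A' B).
all: try by move=> s; move: (sA s) (dA'B s); rewrite !inE;
  case: (s \in A) => [/(_ isT)->|_] //=; do !case: (_ \in _).
  exact: AB.
by apply: egt0S A0; apply/subsetP.
Qed.

Lemma egt_monor (A B B' : {set S}) : B' \subset B -> A :&: B = set0 ->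
  egt A B -> egt A B'.
Proof.
move=> /subsetP sB /setP dAB AB.
have A0 : egt A set0 by apply: egt_gt0 AB; apply/setP.
(* On [A], [B'], [B :\: B'] the levels are 2,1,1, then 1,2,2, then 0,2,1: the last step gives up
   [B :\: B'] at no gain elsewhere. *)
apply: (@egt_levels
  (fun s => if s \in A then 2 else if s \in B then 1 else 0)%N
  (fun s => if s \in A then 1 else if s \in B then 2 else 0)%N
  (fun s => if s \in A then 0 else if s \in B' then 2 else
            if s \in B then 1 else 0)%N A B (A :|: (B :\: B')) set0 A B').
all: try by move=> s; move: (sB s) (dAB s); rewrite !inE;
  case: (s \in B') => [/(_ isT)->|_] //=; do !case: (_ \in _).
  exact: AB.
by apply: egt0S A0; apply: subsetUl.
Qed.

Lemma egtUr (A B C : {set S}) : A :&: B = set0 -> A :&: C = set0 ->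
  egt A B -> egt A C -> egt A (B :|: C).
Proof.
move=> /setP dAB /setP dAC AB AC.
(* The middle act is 1 on all of [A :|: B :|: C]. The first differs from it by a gain on [A] and a
   loss on [B], the third by a loss on [A] and a gain on [C]. *)
apply: (@egt_levels
  (fun s => if s \in A then 2 else if s \in C :\: B then 1 else 0)%N
  (fun s => if s \in A then 1 else if s \in C :\: B then 1 else
            if s \in B then 1 else 0)%N
  (fun s => if s \in A then 0 else if s \in C then 2 else
            if s \in B then 1 else 0)%N A B A C A (B :|: C)).
all: try by move=> s; move: (dAB s) (dAC s); rewrite !inE;
  do !case: (_ \in _).
  exact: AB.
exact: AC.
Qed.

(** * A single state of the winning event suffices *)

(** If [a :|: b >= c] held, RM restricted to [a :|: b] would turn [a :|: c > b] into [a > b]. *)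
Lemma egt_shift (a b c : {set S}) : a :&: b = set0 -> a :&: c = set0 ->
  b :&: c = set0 -> ege b a -> egt (a :|: c) b -> egt c (a :|: b).
Proof.
move=> /setP dab /setP dac /setP dbc ba acb; apply/egtN => h.
have d : (a :|: c) :&: b = set0.
  by apply/setP=> s; move: (dab s) (dac s) (dbc s); rewrite !inE;
    do !case: (_ \in _).
have := egt_RM (C := a :|: b) d acb.
have -> : (a :|: c :|: b) :&: (a :|: b) = a :|: b.
  by apply/setP=> s; rewrite !inE; do !case: (_ \in _).
have -> : (a :|: c :|: b) :\: (a :|: b) = c.
  by apply/setP=> s; move: (dab s) (dac s) (dbc s); rewrite !inE;
    do !case: (_ \in _).
have -> : (a :|: c) :&: (a :|: b) = a.
  by apply/setP=> s; move: (dab s) (dac s) (dbc s); rewrite !inE;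
    do !case: (_ \in _).
by rewrite setKU => /(_ h) [].
Qed.

Lemma egt_witness (A B : {set S}) : A :&: B = set0 -> egt A B ->
  exists2 s, s \in A & egt [set s] B.
Proof.
move: {2}#|A| (leqnn #|A|) => n; elim: n A => [|n IHn] A.
  by rewrite leqn0 cards_eq0 => /eqP-> _ [_ []]; apply: event_geq0.
move=> leA dAB AB; have [A0|[s sA]] := set_0Vmem A.
  by case: AB => _ []; rewrite A0; apply: event_geq0.
have [sB|/egtNN sB] := EM (egt [set s] B); first by exists s.
have dAs t : t \in A -> t \in B = false.
  by move=> tA; have /setP/(_ t) := dAB; rewrite !inE tA.
have dB : (A :\ s) :&: B = set0.
  by apply/setP=> t; rewrite !inE; apply/negP=> /andP[/andP[_ /dAs->]].
(* Since [B >= {s}], the state [s] can be moved to the losing side, then dropped by monotonicity for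
   the induction. *)
have AsB : egt (A :\ s) (s |: B).
  apply: egt_shift => //; last by rewrite setD1K.
  - by apply/setP=> t; rewrite !inE; case: eqP => // ->; rewrite dAs.
  - by apply/setP=> t; rewrite !inE; case: eqP.
  - by rewrite setIC.
have dsB : (A :\ s) :&: (s |: B) = set0.
  by rewrite setIUr dB setU0; apply/setP=> t; rewrite !inE; case: eqP; rewrite ?andbF.
have [|t] := IHn _ _ dB (egt_monor (subsetUr _ _) dsB AsB).
  by move: leA; rewrite (cardsD1 s) sA.
by rewrite !inE => /andP[_ tA] tB; exists t.
Qed.

(** * Ranking of the states *)

(** Counting the events that [{s}] beats gives a numerical scale; the empty event is among them
    exactly when [{s}] is not null. *)
Definition rank (s : S) : nat :=
  #|[set B : {set S} | (s \notin B) && `[< egt [set s] B >]]|.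

Lemma set1I0 (s : S) (B : {set S}) : s \notin B -> [set s] :&: B = set0.
Proof. by move=> /negbTE sB; apply/setP=> t; rewrite !inE; case: eqP => // ->. Qed.

Lemma egt1_mono (s t : S) (B : {set S}) : s \notin B ->
  ege [set t] [set s] -> egt [set s] B -> (t \notin B) /\ egt [set t] B.
Proof.
move=> sB ts; have [<-|nst] := eqVneq s t; first by [].
move=> gsB; have tB : t \notin B.
  apply/negP=> tB; have [_] // : egt [set s] [set t].
  by apply: egt_monor gsB; rewrite ?sub1set ?set1I0.
split=> //; apply: contrapT => /egtNN Bt.
have d : [set t] :&: [set s] = set0 by apply: set1I0; rewrite inE eq_sym.
(* If [B >= {t}], shifting [t] to the losing side of [{s, t} > B] gives [{s} > {t}], a
   contradiction. *)
have : egt [set s] (t |: B).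
  apply: egt_shift => //; rewrite ?set1I0 // 1?setIC ?set1I0 //.
  apply: egt_monol gsB; first exact: subsetUr.
  by rewrite setIUl !set1I0 // setU0.
move/(egt_monor (subsetUl _ _)); rewrite set1I0 ?inE ?negb_or ?nst // => -[] //.
Qed.

(** The families of beaten events are nested by [egt1_mono], so their cardinals order the
    singletons. *)
Lemma rankP (s t : S) : (rank t <= rank s)%N <-> ege [set s] [set t].
Proof.
split=> [le|st]; last first.
  apply: subset_leq_card; apply/subsetP=> B; rewrite !inE => /andP[tB /asboolP].
  by move=> /(egt1_mono tB st)[-> ?]; apply/asboolP.
apply: contrapT => /egtN ts; move: le; rewrite leqNgt => /negP; apply.
have nst : t != s by apply/eqP=> e; case: ts; rewrite e.
apply: proper_card; apply/properP; split.
  apply/subsetP=> B; rewrite !inE => /andP[sB /asboolP].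
  by have [ts1 _] := ts; move=> /(egt1_mono sB ts1)[-> ?]; apply/asboolP.
(* [{s}] is counted for [t] but not for [s], as it contains [s]. *)
exists [set s]; rewrite !inE ?eqxx // nst; exact/asboolP.
Qed.

Lemma rank_gt0 (s : S) : (0 < rank s)%N <-> egt [set s] set0.
Proof.
split=> [|s0]; last first.
  by apply/card_gt0P; exists set0; rewrite !inE; apply/asboolP.
case/card_gt0P=> B; rewrite inE => /andP[sB /asboolP].
by apply: egt_gt0; rewrite set1I0.
Qed.

(** A winning state comes from [egt_witness]; conversely [egtUr] collects the states of [B] one by
    one. Positivity of the rank covers empty [B]. *)
Lemma rank_egt (A B : {set S}) : A :&: B = set0 ->
  egt A B <-> exists2 s, s \in A &
    (0 < rank s)%N /\ forall t, t \in B -> (rank t < rank s)%N.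
Proof.
move=> dAB; have dA s : s \in A -> s \notin B.
  by move=> sA; have /setP/(_ s) := dAB; rewrite !inE sA /= => ->.
split=> [/(egt_witness dAB)[s sA sB]|[s sA [s0 sB]]].
  exists s => //; split; first by apply/rank_gt0; apply: egt_gt0 sB; rewrite set1I0 ?dA.
  move=> t tB; rewrite ltnNge; apply/negP => /rankP.
  suff [] : egt [set s] [set t] by [].
  by apply: egt_monor sB; rewrite ?sub1set ?set1I0 ?dA.
apply: (@egt_monol [set s]); rewrite ?sub1set //.
move: (dA s sA) sB => {dA dAB A sA}.
move: {2}#|B| (leqnn #|B|) => n; elim: n B => [|n IHn] B.
  by rewrite leqn0 cards_eq0 => /eqP-> _ _; apply/rank_gt0.
move=> leB sB lt; have [->|[t tB]] := set_0Vmem B; first exact/rank_gt0.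
rewrite -(setD1K tB); apply: egtUr.
- by apply: set1I0; rewrite inE; apply: contraNneq sB => ->.
- by apply: set1I0; rewrite !inE negb_and sB orbT.
- by apply/egtN => /rankP; rewrite leqNgt lt.
- apply: IHn; first by move: leB; rewrite (cardsD1 t) tB.
    by rewrite !inE negb_and sB orbT.
  by move=> u; rewrite !inE => /andP[_ /lt].
Qed.

(** * Transitivity of preference on consequences *)

Lemma csq_geq_trans (s t : S) : s != t ->
  egt [set s] set0 -> egt [set t] set0 ->
  forall a b c, cge a b -> cge b c -> cge a c.
Proof.
wlog ts : s t / ege [set s] [set t] => [wl nst s0 t0|].
  have [h|h] := event_geq_total [set s] [set t]; first exact: (wl s t).
  by apply: (wl t s); rewrite // eq_sym.
move=> nst s0 t0 a b c ab bc; apply: contrapT => /cgtN ca.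
have ba : cge b a.
  by apply: contrapT => /cgtN h; have [_] := cgt_trans ca h.
have cb : cge c b.
  by apply: contrapT => /cgtN h; have [_] := cgt_trans h ca.
(* With [a ~ b ~ c] but [c > a], put [a], [b], [c] on [s] and [x], [y], [z] on [t]. Each act beats
   the next through [t] alone, so the first beats the third, that is, [{t} > {s}], against
   [{s} >= {t}]. *)
pose act p q := fun r : S => if r == s then p else if r == t then q else x.
have st : t != s by rewrite eq_sym.
have bet p q p' q' : better_set (act p q) (act p' q') =
    [set r in [set s] | `[< cgt p p' >]] :|: [set r in [set t] | `[< cgt q q' >]].
  apply/setP=> r; rewrite !inE /act; case: (eqVneq r s) => [->|].
    by rewrite (negbTE nst) /= orbF.
  case: (eqVneq r t) => //= _ _; apply/asboolP => -[] //.
have no p q : cge q p -> `[< cgt p q >] = false.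
  by move=> h; apply/asboolP => -[].
have yes p q : cgt p q -> `[< cgt p q >] = true by move=> h; apply/asboolP.
have set0r (A : {set S}) : [set r in A | false] = set0.
  by apply/setP=> r; rewrite !inE andbF.
have setTr (A : {set S}) : [set r in A | true] = A.
  by apply/setP=> r; rewrite !inE andbT.
have [[xy1 yx] [yz1 zy]] := (xy, yz); have [xz zx] := cgt_trans xy yz.
have [ca1 ac] := ca.
have : strict_part geq (act a x) (act c z).
  apply: (@gt_acts_trans _ (act b y)); apply/gt_better; rewrite !bet.
    by rewrite (no a b) // (no b a) // (yes x y) // (no y x) // !set0r setTr !set0U.
  by rewrite (no b c) // (no c b) // (yes y z) // (no z y) // !set0r setTr !set0U.
rewrite gt_better !bet (no a c) // (yes c a) // (yes x z) // (no z x) //.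
by rewrite !set0r !setTr set0U setU0 => -[].
Qed.

(** * Possibility distribution and representation by necessity *)

Variable R : realType.

(** A rank is at most the number of events, so this quotient lies in the unit interval; the
    successor keeps the denominator visibly positive. *)
Definition rank_poss (s : S) : R := (rank s)%:R / (#|{set S}|.+1)%:R.

Lemma card_sets_gt0 : 0 < (#|{set S}|.+1)%:R :> R.
Proof. by rewrite ltr0n. Qed.

Lemma rank_poss_le s t : (rank_poss s <= rank_poss t) = (rank s <= rank t)%N.
Proof. by rewrite /rank_poss ler_pM2r ?invr_gt0 ?card_sets_gt0 // ler_nat. Qed.

Lemma rank_poss_lt s t : (rank_poss s < rank_poss t) = (rank s < rank t)%N.
Proof. by rewrite ltNge rank_poss_le -ltnNge. Qed.

Lemma rank_poss_gt0 s : (0 < rank_poss s) = (0 < rank s)%N.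
Proof. by rewrite /rank_poss pmulr_lgt0 ?invr_gt0 ?card_sets_gt0 // ltr0n. Qed.

Lemma rank_poss_bounds s : 0 <= rank_poss s <= 1.
Proof.
rewrite /rank_poss divr_ge0 //= ler_pdivrMr ?card_sets_gt0 // mul1r ler_nat.
by apply: leqW; apply: max_card.
Qed.

(** The positivity clause reflects the default 0 of the maximum. *)
Lemma Poss_ltP (A B : {set S}) : Poss rank_poss B < Poss rank_poss A <->
  exists2 s, s \in A &
    (0 < rank s)%N /\ forall t, t \in B -> (rank t < rank s)%N.
Proof.
split=> [/bigmax_gtP|[s sA [s0 sB]]].
  case=> [|[s sA]].
    by rewrite ltNge bigmax_ge_id.
  case/bigmax_ltP; rewrite rank_poss_gt0 => s0 sB; exists s => //.
  by split=> // t /sB; rewrite rank_poss_lt.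
apply: (@lt_le_trans _ _ (rank_poss s)); last exact: le_bigmax_cond.
by apply/bigmax_ltP; split=> [|t /sB]; rewrite ?rank_poss_gt0 ?rank_poss_lt.
Qed.

Lemma exists_rank_gt0 : exists s, (0 < rank s)%N.
Proof.
suff /rank_egt[|s _ [s0 _]] : egt [set: S] set0; first by rewrite setI0.
  by exists s.
apply/egtN => /event_geqE h; case: xy => _; apply.
by move: h; congr (geq _ _); apply: funext => s; rewrite /binary_act /glue inE.
Qed.

Lemma necessity_rank_poss :
  necessity_ordering_from R (fun s t => rank_poss t <= rank_poss s)
    (fun A B => Nec rank_poss B <= Nec rank_poss A).
Proof.
exists rank_poss; split=> // [s|]; first exact: rank_poss_bounds.
have [s s0] := exists_rank_gt0.
apply: (@lt_le_trans _ _ (rank_poss s)); first by rewrite rank_poss_gt0.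
by apply: le_bigmax_cond; rewrite inE.
Qed.

(** Both orders are total, so it suffices to match the reversed strict comparisons. *)
Lemma geq_Nec (ge_P : X -> X -> Prop) :
  (forall f g, egt (better_set g f) (better_set f g) <->
     Poss rank_poss (~: weak_set ge_P g f) < Poss rank_poss (~: weak_set ge_P f g)) ->
  forall f g, geq f g <-> Nec rank_poss (weak_set ge_P g f) <=
                          Nec rank_poss (weak_set ge_P f g).
Proof.
move=> h f g; rewrite geq_better -egtNN h /Nec lerD2l lerN2 leNgt.
by split=> /negP.
Qed.

Lemma csq_representation : (forall a b c, cge a b -> cge b c -> cge a c) ->
  forall f g, geq f g <-> Nec rank_poss (weak_set cge g f) <=
                          Nec rank_poss (weak_set cge f g).
Proof.
move=> tr; apply: geq_Nec => f g.
by rewrite rank_egt ?better_setI // Poss_ltP -!better_setC !setCK.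
Qed.

(* With a single non-null state, the indifference relation on consequences need
   not be transitive, so indifferent consequences are made incomparable. *)
Definition eq_or_gt (a b : X) : Prop := a = b \/ cgt a b.

Lemma eq_or_gt_preorder : PreOrder eq_or_gt.
Proof.
split=> [a|a b c]; first by left.
case=> [->//|ab] [<-|bc]; right => //; exact: cgt_trans ab bc.
Qed.

Lemma eq_or_gt_representation :
  (forall s t, (0 < rank s)%N -> (0 < rank t)%N -> s = t) ->
  forall f g, geq f g <-> Nec rank_poss (weak_set eq_or_gt g f) <=
                          Nec rank_poss (weak_set eq_or_gt f g).
Proof.
move=> uniq; apply: geq_Nec => f g.
rewrite rank_egt ?better_setI // Poss_ltP.
(* All other states have rank 0, so only [s] itself can prevent domination. If [f s] and [g s] are
   distinct and indifferent, [s] lies in both complements and the possibilities tie. *)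
have lt (B : {set S}) s : (0 < rank s)%N ->
    (forall t, t \in B -> (rank t < rank s)%N) <-> s \notin B.
  move=> s0; split=> [sB|sB t tB]; first by apply/negP=> /sB; rewrite ltnn.
  have [t0|] := ltnP 0 (rank t); last by move=> /leq_ltn_trans; apply.
  by move: sB; rewrite (uniq s t) // tB.
split=> -[s sA [s0 /(lt _ _ s0) sB]]; exists s => //; last first.
- split=> //; apply/(lt _ _ s0); move: sA sB; rewrite !inE negbK.
  by move=> /asboolP nfg _; apply/asboolP => fg; apply: nfg; right.
- move: sA sB; rewrite !inE negbK => /asboolP nfg /asboolP[e|gf].
    by case: nfg; left.
  exact/asboolP.
- split=> //; apply/(lt _ _ s0); move: sA; rewrite !inE negbK => /asboolP gf.
  by apply/asboolP; right.
- move: sA; rewrite !inE => /asboolP[gf nfg]; apply/asboolP => -[e|[]//].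
  by apply: nfg; rewrite e; apply: geq_refl.
Qed.

End Representation.

Theorem mainTheorem14 (R : realType) (S : finType) (X : Type)
    (geq : (S -> X) -> (S -> X) -> Prop)
    (hP1 : axiom_P'1 geq) (hP2 : axiom_P2 geq) (hP3 : axiom_P3 geq)
    (hP4 : axiom_P4 geq) (hP5 : axiom_P5' geq) (hL : axiom_L geq)
    (hU : axiom_U geq) (hRM : axiom_RM geq) :
  exists (geq_pi : S -> S -> Prop) (geq_P : X -> X -> Prop)
         (geq_N : {set S} -> {set S} -> Prop),
    [/\ PreOrder geq_pi,
        PreOrder geq_P,
        necessity_ordering_from R geq_pi geq_N
      & forall f g : S -> X,
          geq f g <-> geq_N (weak_set geq_P f g) (weak_set geq_P g f)].
Proof.
have [x [y [z [xy yz]]]] := hP5.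
pose pi := @rank_poss S X geq R.
have preorder_pi : PreOrder (fun s t => pi t <= pi s).
  by split=> [s|s t u st tu]; [exact: lexx|exact: le_trans tu st].
have nec := necessity_rank_poss hP1 hP2 hP3 hP4 hL hRM xy yz R.
(* If [>=] on consequences is transitive, it serves as [geq_P]; otherwise two distinct states of
   positive rank would contradict [csq_geq_trans]. *)
have [tr|ntr] := EM (forall a b c, csq_geq geq a b -> csq_geq geq b c -> csq_geq geq a c).
  exists (fun s t => pi t <= pi s), (csq_geq geq), (fun A B => Nec pi B <= Nec pi A).
  split=> //; first by split=> // a; apply: geq_refl.
  by move=> f g; apply: (csq_representation hP1 hP2 hP3 hP4 hL hRM xy yz).
exists (fun s t => pi t <= pi s), (eq_or_gt geq), (fun A B => Nec pi B <= Nec pi A).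
split=> //; first exact: eq_or_gt_preorder.
move=> f g; apply: (eq_or_gt_representation hP1 hP2 hP3 hP4 hL hRM xy yz).
move=> s t s0 t0; apply: contrapT => /eqP nst; apply: ntr.
have pos := rank_gt0 hRM.
exact: (csq_geq_trans hP1 hP2 hP4 hL xy yz nst (iffLR (pos s) s0) (iffLR (pos t) t0)).
Qed.
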